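(* Let $B=[b_{ij}]$ be a skew-symmetric $N\times N$ integer matrix, let $\mathbf{u}=(u_1,\ldots,u_N)$ be the initial cluster, let $$\omega=\sum_{1\le i<j\le N} b_{ij}\,\frac{du_i}{u_i}\wedge\frac{du_j}{u_j}$$ be the standard log presymplectic form associated to $B$, and let $1\le m\le N$. Then the following are equivalent: 1. $\mu_m\circ\mu_{m-1}\circ\cdots\circ\mu_1(B)=\sigma^{-m}B\,\sigma^{m}$ (matrix mutations, and $\sigma$ the permutation matrix). 2. $\varphi^*\omega=\omega$, where $\varphi=\sigma^m\circ\mu_m\circ\mu_{m-1}\circ\cdots\circ\mu_1$ (cluster mutations started from the initial seed $(B,\mathbf{u})$, and $\sigma$ the coordinate permutation).
   Context: Permutation: $\sigma$ denotes both the map $\sigma(u_1,u_2,\ldots,u_N)=(u_2,\ldots,u_N,u_1)$ and the $N\times N$ permutation matrix with entries $\sigma_{i,i+1}=1$ for $1\le i\le N-1$, $\sigma_{N,1}=1$, and all other entries $0$. Mutation of a matrix: for a skew-symmetric integer matrix $B=[b_{ij}]$ and $k\in\{1,\ldots,N\}$, $\mu_k(B)=[b'_{ij}]$ with $b'_{ij}=-b_{ij}$ if $i=k$ or $j=k$, and $b'_{ij}=b_{ij}+\frac12\left(|b_{ik}|b_{kj}+b_{ik}|b_{kj}|\right)$ otherwise. Mutation of a cluster: for a seed $(B,\mathbf{u})$, $\mu_k(u_1,\ldots,u_N)=(u'_1,\ldots,u'_N)$ with $u'_i=u_i$ for $i\ne k$ and $$u'_k=\frac{\prod_{j:\,b_{kj}>0}u_j^{b_{kj}}+\prod_{j:\,b_{kj}<0}u_j^{-b_{kj}}}{u_k},$$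 where empty products equal $1$. Mutations act on seeds: a mutation transforms matrix and cluster simultaneously. Hence in the composition $\mu_m\circ\cdots\circ\mu_1$ of cluster mutations started at $(B,\mathbf{u})$, the cluster map $\mu_k$ is the one defined by the matrix $\mu_{k-1}\circ\cdots\circ\mu_1(B)$ (by $B$ itself when $k=1$). The cluster maps are regarded as birational maps in the variables $u_1,\ldots,u_N$; they restrict to diffeomorphisms of $\mathbb{R}_+^N$, where $\mathbb{R}_+=(0,\infty)$. *)

(* Defs.v *)
From HB Require Import structures.
From mathcomp Require Import all_boot all_order all_algebra.
From mathcomp Require Import all_classical all_reals all_analysis.
Set Implicit Arguments.
Unset Strict Implicit.
Unset Printing Implicit Defensive.
Import Order.TTheory GRing.Theory Num.Theory.
Import numFieldNormedType.Exports.
Local Open Scope ring_scope.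

(* Indices 1, ..., N are the ordinals 0, ..., N-1 of 'I_N, and a cluster
   (u_1, ..., u_N) is a row vector. *)

(* ordS is the cyclic successor on 'I_N. *)
Definition sigma_mx (N : nat) : 'M[int]_N :=
  \matrix_(i, j) (j == ordS i)%:R.

Definition sigma_map (T : Type) (N : nat) (u : 'rV[T]_N) : 'rV[T]_N :=
  \row_i u ord0 (ordS i).

(* The Euclidean quotient by 2 in mutate_mx is exact. *)
Lemma mutation_even (x y : int) : (2 %| `|x| * y + x * `|y|)%Z.
Proof.
have even_dbl (z : int) : (2 %| z + z)%Z.
  have -> : z + z = z * 2%:Z by rewrite -mulr2n -mulr_natr.
  exact: dvdz_mull.
have [x0|x0] := leP 0 x; have [y0|y0] := leP 0 y.
- by rewrite !ger0_norm.
- by rewrite ger0_norm // ltr0_norm // mulrN subrr dvdz0.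
- by rewrite ltr0_norm // ger0_norm // mulNr addNr dvdz0.
- by rewrite !ltr0_norm // mulNr mulrN; apply: even_dbl.
Qed.

Definition mutate_mx (N : nat) (k : 'I_N) (B : 'M[int]_N) : 'M[int]_N :=
  \matrix_(i, j)
    if (i == k) || (j == k) then - B i j
    else B i j + ((`|B i k| * B k j + B i k * `|B k j|) %/ 2)%Z.

Definition mutate_cluster (R : realType) (N : nat) (k : 'I_N)
    (B : 'M[int]_N) (u : 'rV[R]_N) : 'rV[R]_N :=
  \row_i
    if i == k then
      (\prod_(j < N | 0 < B k j) u ord0 j ^ B k j
       + \prod_(j < N | B k j < 0) u ord0 j ^ (- B k j)) / u ord0 k
    else u ord0 i.

Definition seed (R : realType) (N : nat) : Type := ('M[int]_N * 'rV[R]_N)%type.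

Definition mutate_seed (R : realType) (N : nat) (s : seed R N) (k : 'I_N) :
    seed R N :=
  (mutate_mx k s.1, mutate_cluster k s.1 s.2).

Definition mutations_mx (N m : nat) (B : 'M[int]_N) : 'M[int]_N :=
  foldl (fun B' k => mutate_mx k B') B (take m (enum 'I_N)).

Definition mutations_seed (R : realType) (N m : nat) (s : seed R N) :
    seed R N :=
  foldl (@mutate_seed R N) s (take m (enum 'I_N)).

Definition phi (R : realType) (N m : nat) (B : 'M[int]_N) (u : 'rV[R]_N) :
    'rV[R]_N :=
  iter m (@sigma_map R N) (mutations_seed m (B, u)).2.

(* Differential forms on (subsets of) R^N: the arguments are the base point
   and then the tangent vectors. *)
Definition one_form (R : realType) (N : nat) : Type :=
  'rV[R]_N -> 'rV[R]_N -> R.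

Definition two_form (R : realType) (N : nat) : Type :=
  'rV[R]_N -> 'rV[R]_N -> 'rV[R]_N -> R.

Definition dlog (R : realType) (N : nat) (i : 'I_N) : one_form R N :=
  fun u v => v ord0 i / u ord0 i.

Definition wedge (R : realType) (N : nat) (a b : one_form R N) :
    two_form R N :=
  fun u v w => a u v * b u w - a u w * b u v.

Definition log_form (R : realType) (N : nat) (B : 'M[int]_N) : two_form R N :=
  fun u v w => \sum_(i < N) \sum_(j < N | (i < j)%N)
    (B i j)%:~R * wedge (dlog i) (dlog j) u v w.
Arguments log_form R {N} B.

Definition pullback (R : realType) (N : nat) (f : 'rV[R]_N -> 'rV[R]_N)
    (w : two_form R N) : two_form R N :=
  fun u v1 v2 => w (f u) ('d f u v1) ('d f u v2).

(* The rational maps and forms used here are regular on the positive orthant,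
   which is Zariski dense, so equality there is equality as rational forms. *)
Definition positive (R : realType) (N : nat) (u : 'rV[R]_N) : Prop :=
  forall i, 0 < u ord0 i.

Definition eq_form_on_positive (R : realType) (N : nat) (w1 w2 : two_form R N) :
    Prop :=
  forall u, positive u -> forall v1 v2, w1 u v1 v2 = w2 u v1 v2.

(* Main.v *)
Require Import Defs.
From HB Require Import structures.
From mathcomp Require Import all_boot all_order all_algebra.
From mathcomp Require Import all_classical all_reals all_analysis.
From mathcomp Require Import ring.
Import Order.TTheory GRing.Theory Num.Theory.
Import numFieldNormedType.Exports.
Local Open Scope ring_scope.

(** Everything is read in logarithmic coordinates: a tangent vector v at a
    positive point u is replaced by the row of the v_i / u_i.  There omega is
    the constant bilinear form with matrix B ([log_formE]), and a map f acts on
    tangent vectors through its logarithmic Jacobian J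
    ([has_log_jacobian]), so that the pullback of omega has matrix J B J^T
    ([pullback_log_form]).

    The key fact is that mutation is compatible with the log forms: the cluster
    mutation mu_k pulls the form of mu_k(B) back to the form of B.  In log
    coordinates mu_k changes only the k-th coordinate, so its Jacobian is
    T = 1 + s e_k.  The column s involves the weight c of the two exchange
    monomials, which varies with u, but c contributes only a multiple of
    b_ki b_kj - b_kj b_ki = 0 to T mu_k(B) T^T, and what remains is B
    ([mutation_congruence]).  Moreover T^2 = 1.  Composing, the mutation
    sequence has at every positive u an invertible J with
    J B' J^T = B, where B' is the mutated matrix ([mutations_jacobian]).

    The cyclic shift is linear with log Jacobian the transpose, which is the
    inverse, of the matrix sigma.  Hence phi^* omega has matrix
    J (sigma^-m B sigma^m) J^T while omega has matrix B = J B' J^T.  Equality of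
    the matrices B' and sigma^-m B sigma^m therefore gives equality of the
    forms at every u; conversely, as J is invertible, equality of the forms at
    the single point (1, ..., 1) gives equality of the matrices. *)

(** * Skew-symmetric integer matrices *)

Lemma skew_entry {N : nat} {B : 'M[int]_N} (hB : B^T = - B) i j :
  B j i = - B i j.
Proof. by move/matrixP/(_ i j): hB; rewrite !mxE. Qed.

Lemma skew_diag {N : nat} {B : 'M[int]_N} (hB : B^T = - B) i : B i i = 0.
Proof. by apply/eqP; rewrite -eqNr -skew_entry. Qed.

Lemma mutate_mx_skew {N : nat} (k : 'I_N) {B : 'M[int]_N} :
  B^T = - B -> (mutate_mx k B)^T = - mutate_mx k B.
Proof.
move=> hB; apply/matrixP => i j; rewrite !mxE orbC.
case: ifP => _; first by rewrite (skew_entry hB).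
rewrite (skew_entry hB i j) (skew_entry hB k j) (skew_entry hB i k) !normrN.
have /dvdzP[q eq] := mutation_even (B i k) (B k j).
have -> : `|B k j| * - B i k + - B k j * `|B i k| = - q * 2%:Z.
  by rewrite [RHS]mulNr -eq; ring.
by rewrite eq !mulzK // opprD.
Qed.

(** * Log forms in logarithmic coordinates *)

Section LogForms.
Context {R : realType} {N : nat}.
Implicit Types (u v w : 'rV[R]_N) (B : 'M[int]_N).

Local Notation intmx B := (map_mx (intr : int -> R) B).

Definition log_coords (u v : 'rV[R]_N) : 'rV[R]_N :=
  \row_i (v ord0 i / u ord0 i).

(** Skew-symmetry lets the pairs with i > j supply the subtracted half of each
    wedge product, so the sum over i < j is a full bilinear form. *)
Lemma log_formE B u v w : B^T = - B ->
  log_form R B u v w =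
  (log_coords u v *m intmx B *m (log_coords u w)^T) ord0 ord0.
Proof.
move=> hB.
pose F i j : R := (B i j)%:~R * (log_coords u v ord0 i * log_coords u w ord0 j).
have -> : (log_coords u v *m intmx B *m (log_coords u w)^T) ord0 ord0 =
    \sum_i \sum_j F i j.
  rewrite mxE exchange_big /=; apply: eq_bigr => j _.
  rewrite mxE mulr_suml; apply: eq_bigr => i _.
  by rewrite /F !mxE; ring.
have -> : \sum_i \sum_j F i j =
    \sum_(i < N) \sum_(j < N | (i < j)%N) F i j +
    \sum_(i < N) \sum_(j < N | (j < i)%N) F i j.
  rewrite -big_split; apply: eq_bigr => i _ /=.
  rewrite (bigID (fun j : 'I_N => (i < j)%N)) /=; congr (_ + _).
  rewrite (bigD1 i) ?ltnn //= /F (skew_diag hB) mul0r add0r.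
  apply: eq_bigl => j; rewrite -leqNgt ltn_neqAle andbC.
  by rewrite (inj_eq val_inj).
rewrite [X in _ + X](exchange_big_dep xpredT) //= -big_split.
apply: eq_bigr => i _ /=; rewrite -big_split; apply: eq_bigr => j _ /=.
by rewrite /F (skew_entry hB i j) rmorphN /wedge /dlog !mxE /=; ring.
Qed.

Lemma log_coords_delta {u} i : positive u ->
  log_coords u (u ord0 i *: delta_mx ord0 i) = delta_mx ord0 i.
Proof.
move=> u0; apply/rowP => j; rewrite !mxE eqxx /=.
by have [->|_] := eqVneq j i; rewrite ?mulr1 ?divff ?gt_eqF // mulr0n mulr0 mul0r.
Qed.

(** The log coordinates at a positive point range over all rows, so a bilinear
    form in them determines its matrix: this is what turns an identity of forms
    at one point into an identity of matrices. *)
Lemma log_coords_bilinear_inj {u} {A B : 'M[R]_N} : positive u ->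
  (forall v w, (log_coords u v *m A *m (log_coords u w)^T) ord0 ord0 =
               (log_coords u v *m B *m (log_coords u w)^T) ord0 ord0) -> A = B.
Proof.
move=> u0 AB; apply/matrixP => i j.
have := AB (u ord0 i *: delta_mx ord0 i) (u ord0 j *: delta_mx ord0 j).
by rewrite !log_coords_delta // !trmx_delta -!rowE -!colE !mxE.
Qed.

(** * Logarithmic gradients *)

(** The column l holds the partial derivatives of log g with respect to the
    log u_i; stating it through g alone avoids logarithms.  On such
    gradients products act additively and powers by scaling. *)
Definition has_log_gradient (g : 'rV[R]_N -> R) u (l : 'cV[R]_N) : Prop :=
  [/\ 0 < g u, differentiable g u
    & forall v, 'd g u v = g u * (log_coords u v *m l) ord0 ord0].

Lemma diff_coord u v i : 'd (fun x : 'rV[R]_N => x ord0 i) u v = v ord0 i.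
Proof.
have @f : {linear 'rV[R]_N -> R}.
  by exists (fun x : 'rV[R]_N => x ord0 i); do 2![eexists]; do ?[constructor];
     rewrite ?mxE// => ? *; rewrite ?mxE//; move=> ?; rewrite !mxE.
by rewrite (_ : (fun _ => _) = f) // diff_lin //; exact: coord_continuous.
Qed.

Lemma has_log_gradient_coord {u} i : positive u ->
  has_log_gradient (fun x => x ord0 i) u (delta_mx i ord0).
Proof.
move=> u0; split=> // [|v]; first exact: differentiable_coord.
by rewrite diff_coord -colE !mxE mulrC divfK // gt_eqF.
Qed.

Lemma has_log_gradient1 u : has_log_gradient (fun=> 1) u 0.
Proof.
by split=> // v; rewrite (diff_cst (1 : R) u) mulmx0 mxE mulr0.
Qed.

Lemma has_log_gradientM {g h u l l'} :
  has_log_gradient g u l -> has_log_gradient h u l' ->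
  has_log_gradient (fun x => g x * h x) u (l + l').
Proof.
move=> [g0 dg eg] [h0 dh eh]; split; first exact: mulr_gt0.
  exact: differentiableM.
move=> v; rewrite (diffM dg dh) -[LHS]/(g u * 'd h u v + h u * 'd g u v).
by rewrite eg eh mulmxDr [in RHS]mxE; ring.
Qed.

Lemma has_log_gradientV {g u l} :
  has_log_gradient g u l -> has_log_gradient (fun x => (g x)^-1) u (- l).
Proof.
move=> [g0 dg eg]; have gn0 : g u != 0 by rewrite gt_eqF.
split; [by rewrite invr_gt0 | exact: differentiableV |].
move=> v; rewrite (diffV dg gn0) -[LHS]/(- (g u) ^- 2 * 'd g u v).
by rewrite eg mulmxN [in RHS]mxE; field.
Qed.

(** The log gradient of a sum is the mean of the log gradients, weighted by the
    values of the summands. *)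
Lemma has_log_gradientD {g h u l l'} :
  has_log_gradient g u l -> has_log_gradient h u l' ->
  has_log_gradient (fun x => g x + h x) u
    ((g u + h u)^-1 *: (g u *: l + h u *: l')).
Proof.
move=> [g0 dg eg] [h0 dh eh]; have gh0 : 0 < g u + h u by exact: addr_gt0.
split=> //; first exact: differentiableD.
move=> v; rewrite (diffD dg dh) -[LHS]/('d g u v + 'd h u v).
rewrite eg eh -scalemxAr mulmxDr -!scalemxAr.
rewrite [in RHS]mxE [X in _ = _ * (_ * X)]mxE.
rewrite [X in _ = _ * (_ * (X + _))]mxE [X in _ = _ * (_ * (_ + X))]mxE.
by rewrite mulVKf // gt_eqF.
Qed.

Lemma has_log_gradientX {g u l} (z : int) :
  has_log_gradient g u l -> has_log_gradient (fun x => g x ^ z) u (z%:~R *: l).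
Proof.
move=> hg.
have nat_case n : has_log_gradient (fun x => g x ^+ n) u (n%:R *: l).
  elim: n => [|n IHn]; first by rewrite scale0r; exact: has_log_gradient1.
  rewrite mulrSr scalerDl scale1r addrC.
  under eq_fun do rewrite exprS.
  exact: has_log_gradientM.
case: z => n; first exact: nat_case.
rewrite NegzE rmorphN scaleNr.
exact: has_log_gradientV (nat_case n.+1).
Qed.

Lemma has_log_gradient_prod {I : Type} (r : seq I) (P : pred I)
    {F : I -> 'rV[R]_N -> R} {u} {l : I -> 'cV[R]_N} :
  (forall i, has_log_gradient (F i) u (l i)) ->
  has_log_gradient (fun x => \prod_(i <- r | P i) F i x) u
    (\sum_(i <- r | P i) l i).
Proof.
move=> hF; elim: r => [|i r IHr].
  under eq_fun do rewrite big_nil.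
  by rewrite big_nil; exact: has_log_gradient1.
under eq_fun do rewrite big_cons.
by rewrite big_cons; case: (P i) => //; exact: has_log_gradientM.
Qed.

(** * Logarithmic Jacobians *)

(** Tangent vectors are rows, so J acts on the right and its i-th column is the
    log gradient of the i-th component. *)
Definition has_log_jacobian (f : 'rV[R]_N -> 'rV[R]_N) u (J : 'M[R]_N) : Prop :=
  [/\ positive (f u), differentiable f u
    & forall v, log_coords (f u) ('d f u v) = log_coords u v *m J].

Lemma has_log_jacobian_id {u} : positive u -> has_log_jacobian id u 1%:M.
Proof.
by move=> u0; split=> // v; rewrite mulmx1 diff_val.
Qed.

Lemma has_log_jacobian_comp {f g u J K} :
  has_log_jacobian f u J -> has_log_jacobian g (f u) K ->
  has_log_jacobian (g \o f) u (J *m K).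
Proof.
move=> [f0 df ef] [g0 dg eg]; split; [exact: g0 | exact: differentiable_comp |].
move=> v; rewrite (diff_comp df dg).
rewrite -[LHS]/(log_coords (g (f u)) ('d g (f u) ('d f u v))).
by rewrite eg ef mulmxA.
Qed.

Lemma has_log_jacobian_coords {f : 'rV[R]_N -> 'rV[R]_N} {u J} :
  (forall i, has_log_gradient (fun x => f x ord0 i) u (col i J)) ->
  has_log_jacobian f u J.
Proof.
move=> hf.
have df : differentiable f u.
  have -> : f = \sum_(i < N) (fun x => f x ord0 i *: delta_mx ord0 i).
    apply/funext => x; rewrite fct_sumE [LHS]matrix_sum_delta big_ord1.
    by apply: eq_bigr.
  apply: differentiable_sum => i.
  by apply: differentiableZl; have [] := hf i.
split=> [i||v] //; first by have [] := hf i.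
apply/rowP => i; have [fi0 _ efi] := hf i.
have -> : (log_coords u v *m J) ord0 i = (log_coords u v *m col i J) ord0 ord0.
  by rewrite !mxE; apply: eq_bigr => j _; rewrite !mxE.
rewrite mxE -(diff_coord (f u)).
have dcoord : differentiable (fun x : 'rV[R]_N => x ord0 i : R) (f u).
  exact: differentiable_coord.
have /(congr1 (fun h => h v)) /= <- := diff_comp df dcoord.
(* The i-th coordinate of 'd f is the differential of the i-th component. *)
rewrite -[X in X / _]/('d (fun x => f x ord0 i) u v) efi.
by rewrite mulrC mulKf // gt_eqF.
Qed.

Lemma pullback_log_form {B} {f u J} v w : B^T = - B -> has_log_jacobian f u J ->
  pullback f (log_form R B) u v w =
  (log_coords u v *m (J *m intmx B *m J^T) *m (log_coords u w)^T) ord0 ord0.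
Proof.
move=> hB [_ _ ef]; rewrite /pullback (log_formE _ _ _ _ hB) !ef trmx_mul.
by rewrite !mulmxA.
Qed.

(** * Mutations *)

(** The log gradient of u'_k is the weighted mean of the exponent columns
    (|b_ki| + b_ki) / 2 and (|b_ki| - b_ki) / 2 of the two exchange monomials,
    minus e_k; c is the difference of the two weights.  A second e_k is
    subtracted because the identity in [mutation_jac] already contributes
    one. *)
Definition exchange_col (k : 'I_N) B (c : R) : 'cV[R]_N :=
  \col_i ((`|(B k i)%:~R| + c * (B k i)%:~R) / 2 - 2 * (i == k)%:R).

Definition mutation_jac (k : 'I_N) B (c : R) : 'M[R]_N :=
  1%:M + exchange_col k B c *m delta_mx ord0 k.

Lemma mutation_jac_mulE k B c (M : 'M[R]_N) i j :
  (mutation_jac k B c *m M) i j = M i j + exchange_col k B c i ord0 * M k j.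
Proof.
rewrite mulmxDl mul1mx -mulmxA -rowE.
by rewrite mxE [X in _ + X]mxE big_ord1 [X in _ + _ * X]mxE.
Qed.

(** As b_kk = 0, the k-th entry of the exchange column s is -2, whence
    (1 + s e_k)^2 = 1 + (2 - 2) s e_k = 1. *)
Lemma mutation_jacK {k B} c : B^T = - B ->
  mutation_jac k B c *m mutation_jac k B c = 1%:M.
Proof.
move=> hB; apply/matrixP => i j.
have E r t : mutation_jac k B c r t =
    (r == t)%:R + exchange_col k B c r ord0 * (k == t)%:R.
  by rewrite -[mutation_jac k B c]mulmx1 mutation_jac_mulE !mxE.
rewrite mutation_jac_mulE !E.
have -> : exchange_col k B c k ord0 = - 2.
  by rewrite !mxE (skew_diag hB) eqxx mulr0z normr0 /=; field.
by rewrite [RHS]mxE; ring.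
Qed.

(** The identity holds for every c, although the two exchange monomials depend
    on the point: off row and column k, the c-terms of entry (i, j) are
    (b_kj b_ki - b_ki b_kj) c / 2, and the |b| terms undo the correction
    made by the matrix mutation. *)
Lemma mutation_congruence {k B} c : B^T = - B ->
  mutation_jac k B c *m intmx (mutate_mx k B) *m (mutation_jac k B c)^T =
  intmx B.
Proof.
move=> hB; apply/matrixP => i j.
(* Right multiplication by the transpose becomes left multiplication, so that
   mutation_jac_mulE applies twice. *)
rewrite -[X in _ *m X *m _]trmxK -mulmxA -trmx_mul.
rewrite mutation_jac_mulE [in X in X + _]mxE [in X in _ + _ * X]mxE.
rewrite !mutation_jac_mulE ![(intmx _)^T _ _]mxE ![intmx _ _ _]mxE.
rewrite ![mutate_mx _ _ _ _]mxE ![exchange_col _ _ _ _ _]mxE eqxx orbT /=.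
rewrite (skew_diag hB).
have [->|ik] := eqVneq i k => /=.
  by rewrite (skew_diag hB) normr0 !rmorphN /=; ring.
have [->|jk] := eqVneq j k => /=.
  by rewrite (skew_diag hB) normr0 !rmorphN /=; ring.
have /dvdzP[q eq] := mutation_even (B i k) (B k j).
have -> : ((`|B i k| * B k j + B i k * `|B k j|) %/ 2)%Z = q
  by rewrite eq mulzK.
rewrite rmorphD /=.
have -> : q%:~R = (`|(B i k)%:~R| * (B k j)%:~R +
                   (B i k)%:~R * `|(B k j)%:~R|) / 2 :> R.
  by rewrite -!intr_norm -!intrM -intrD eq intrM; field.
by rewrite (skew_entry hB k i) oppr0 !rmorphN /= !normrN; field.
Qed.

Lemma sum_delta_mxE (P : pred 'I_N) (z : 'I_N -> R) j :
  (\sum_(i | P i) z i *: delta_mx i ord0 : 'cV[R]_N) j ord0 =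
  if P j then z j else 0.
Proof.
rewrite summxE big_mkcond (bigD1 j) //= big1 ?addr0 => [|i ij].
  by rewrite !mxE !eqxx mulr1.
by rewrite !mxE eq_sym (negPf ij) mulr0 if_same.
Qed.

(** With P and M the two exchange monomials, the weights of their log gradients
    in P + M are P / (P + M) and M / (P + M), hence the value of c. *)
Lemma mutate_cluster_jacobian {k B u} : B^T = - B -> positive u ->
  exists c, has_log_jacobian (mutate_cluster k B) u (mutation_jac k B c).
Proof.
move=> hB u0.
have hcoord i := has_log_gradient_coord i u0.
have hP := has_log_gradient_prod (index_enum 'I_N) (fun j => 0 < B k j)
  (fun j => has_log_gradientX (B k j) (hcoord j)).
have hM := has_log_gradient_prod (index_enum 'I_N) (fun j => B k j < 0)
  (fun j => has_log_gradientX (- B k j) (hcoord j)).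
have hk := has_log_gradientM (has_log_gradientD hP hM)
  (has_log_gradientV (hcoord k)).
move: hk; case: hP => P0 _ _; case: hM => M0 _ _.
set P := \prod_(j <- _ | _) _ in P0; set M := \prod_(j <- _ | _) _ in M0.
rewrite -/P -/M => hk.
have PM0 : P + M != 0 by rewrite gt_eqF ?addr_gt0.
exists ((P - M) / (P + M)); apply: has_log_jacobian_coords => i.
have [->|ik] := eqVneq i k.
  under eq_fun do rewrite mxE eqxx.
  congr has_log_gradient: hk; apply/colP => j.
  rewrite [in RHS]mxE -[mutation_jac _ _ _]mulmx1 mutation_jac_mulE.
  rewrite [in LHS]mxE [X in X + _]mxE ![X in _ * X + _]mxE.
  rewrite [X in _ * (X + _)]mxE [X in _ * (_ + X)]mxE !sum_delta_mxE.
  rewrite [(- _ : 'cV__) _ _]mxE [delta_mx _ _ _ _]mxE [exchange_col _ _ _ _ _]mxE.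
  rewrite ![1%:M _ _]mxE eqxx andbT.
  rewrite mulr1n mulr1; move: (_%:R) => d.
  have [b0|b0|->] := ltrgtP (B k j) 0.
  - by rewrite ltr0_norm ?ltrz0 // rmorphN /=; field.
  - by rewrite gtr0_norm ?ltr0z //; field.
  by rewrite mulr0z normr0; field.
under eq_fun do rewrite mxE (negPf ik).
have -> : col i (mutation_jac k B ((P - M) / (P + M))) = delta_mx i ord0.
  apply/colP => j; rewrite mxE -[mutation_jac _ _ _]mulmx1 mutation_jac_mulE.
  by rewrite !mxE andbT [k == i]eq_sym (negPf ik) mulr0 addr0.
exact: hcoord.
Qed.

(** Each step pulls the form of the new matrix back to the form of the old one,
    so along any sequence of mutations the congruences chain: the final matrix
    is congruent to B by the Jacobian of the composite. *)
Lemma mutations_jacobian ks B u : B^T = - B -> positive u ->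
  let B' := foldl (fun A k => mutate_mx k A) B ks in
  exists J, [/\ J \in unitmx,
    has_log_jacobian (fun x => (foldl (@mutate_seed R N) (B, x) ks).2) u J
    & J *m intmx B' *m J^T = intmx B].
Proof.
elim: ks B u => [|k ks IHks] B u hB u0 /=.
  exists 1%:M; split=> //; first exact: unitmx1.
    exact: has_log_jacobian_id.
  by rewrite mul1mx trmx1 mulmx1.
have [c hk] := @mutate_cluster_jacobian k B u hB u0.
have [J [Ju hJ eJ]] := IHks _ (mutate_cluster k B u) (mutate_mx_skew k hB)
  (let: And3 p _ _ := hk in p).
exists (mutation_jac k B c *m J); split=> //.
- by rewrite unitmx_mul Ju (mulmx1_unit (mutation_jacK c hB)).1.
- exact: has_log_jacobian_comp hk hJ.
rewrite trmx_mul -[RHS](@mutation_congruence k B c hB) -eJ.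
by rewrite !mulmxA.
Qed.

(** * The cyclic shift *)

Lemma sigma_map_jacobian {u} : positive u ->
  has_log_jacobian (@sigma_map R N) u (intmx (sigma_mx N))^T.
Proof.
move=> u0; apply: has_log_jacobian_coords => i.
have -> : col i (intmx (sigma_mx N))^T = delta_mx (ordS i) ord0.
  by apply/colP => j; rewrite !mxE andbT; case: eqP.
under eq_fun do rewrite mxE.
exact: has_log_gradient_coord.
Qed.

Lemma iter_sigma_map_jacobian m {u} : positive u ->
  has_log_jacobian (iter m (@sigma_map R N)) u (intmx (sigma_mx N ^+ m))^T.
Proof.
move=> u0; elim: m => [|m IHm].
  by rewrite expr0 map_mx1 trmx1; exact: has_log_jacobian_id.
rewrite exprS map_mxM trmx_mul.
by apply: has_log_jacobian_comp (IHm) _; apply: sigma_map_jacobian; case: IHm.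
Qed.

End LogForms.

Lemma sigma_mxK N : (sigma_mx N)^T *m sigma_mx N = 1%:M.
Proof.
apply/matrixP => i j; rewrite !mxE (bigD1 (ord_pred i)) //= !mxE ord_predK eqxx.
rewrite mul1r big1 ?addr0 1?eq_sym // => k ki.
rewrite !mxE; case: eqP => [e|_]; last by rewrite mul0r.
by rewrite e ordSK eqxx in ki.
Qed.

Lemma invmx_sigma N m : invmx (sigma_mx N ^+ m) = (sigma_mx N ^+ m)^T.
Proof.
have sK : (sigma_mx N ^+ m)^T *m sigma_mx N ^+ m = 1%:M.
  elim: m => [|m IHm]; first by rewrite expr0 trmx1 mulmx1.
  rewrite [in X in X^T]exprS exprS trmx_mul mulmxA -[_ *m _ *m sigma_mx N]mulmxA.
  by rewrite sigma_mxK mulmx1.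
rewrite -[LHS]mul1mx -sK mulmxK //.
by have [] := mulmx1_unit sK.
Qed.

(** * The equivalence *)

Theorem theorem1 (R : realType) (N m : nat) (B : 'M[int]_N)
    (hB : B^T = - B) (hm1 : (1 <= m)%N) (hmN : (m <= N)%N) :
  mutations_mx m B = invmx (sigma_mx N ^+ m) *m B *m (sigma_mx N ^+ m)
  <->
  eq_form_on_positive (pullback (phi m B) (log_form R B))
    (log_form R B).
Proof.
pose S := map_mx (intr : int -> R) (sigma_mx N ^+ m).
pose B' := mutations_mx m B.
have phi_pullback u : positive u -> exists2 J : 'M[R]_N, J \in unitmx &
    J *m map_mx intr B' *m J^T = map_mx intr B /\
    forall v w, pullback (phi m B) (log_form R B) u v w =
      (log_coords u v *m (J *m (S^T *m map_mx intr B *m S) *m J^T) *m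
       (log_coords u w)^T) ord0 ord0.
  move=> u0.
  have [J [Ju hJ eJ]] := @mutations_jacobian R N (take m (enum 'I_N)) B u hB u0.
  exists J => //; split=> // v w.
  have hphi : has_log_jacobian (phi m B) u (J *m S^T).
    apply: has_log_jacobian_comp (hJ) _.
    by apply: iter_sigma_map_jacobian; case: hJ.
  by rewrite (pullback_log_form _ _ hB hphi) trmx_mul trmxK !mulmxA.
rewrite invmx_sigma -/B'; split=> [eB|eB].
  move=> u u0 v w; have [J _ [eJ ->]] := phi_pullback u u0.
  by rewrite (log_formE _ _ _ _ hB) -[in RHS]eJ eB !map_mxM -map_trmx.
have u0 : positive (const_mx 1 : 'rV[R]_N) by move=> i; rewrite mxE.
have [J Ju [eJ phiE]] := phi_pullback _ u0.
have Jt : J^T \in unitmx by rewrite unitmx_tr.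
suff /matrixP eqS : map_mx (intr : int -> R) B' =
    map_mx intr ((sigma_mx N ^+ m)^T *m B *m sigma_mx N ^+ m).
  by apply/matrixP => i j; apply: (@intr_inj R); have := eqS i j; rewrite !mxE.
rewrite !map_mxM -map_trmx.
apply: (can_inj (mulKmx Ju)); apply: (can_inj (mulmxK Jt)).
rewrite eJ; apply: (log_coords_bilinear_inj u0) => v w.
by rewrite -phiE eB // (log_formE _ _ _ _ hB).
Qed.
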